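(* Let $a>0$, $\operatorname{Re}(b)>0$, and let $\lambda,s$ be complex with $\operatorname{Re}(s)>0$ and $|s^{a}|>|\lambda|$. Then, for real $x\to\infty$, $$\lim_{x\to\infty}\Gamma(xs+1)\,x^{b}\,E_{a,b+xs+1}\left(\lambda x^{a}\right)=\frac{s^{a-b}}{s^{a}-\lambda}.$$
   Context: The Mittag-Leffler function is $E_{a,b}(z)=\sum_{k=0}^{\infty}\frac{z^{k}}{\Gamma(b+ak)}$ for $\operatorname{Re}(a)>0$, with $1/\Gamma$ the entire reciprocal Gamma function. Powers of $s$ use the principal branch. *)

(* Defs.v *)
From Stdlib Require Import Reals Factorial.
From Coquelicot Require Import Coquelicot.

Open Scope R_scope.
Open Scope C_scope.

Definition Cexp (z : C) : C := RtoC (exp (Re z)) * (cos (Im z), sin (Im z)).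

(* Principal argument, with values in (-PI, PI]; junk value at 0. *)
Definition Carg (z : C) : R :=
  if Rle_dec 0 (Im z) then acos (Re z / Cmod z) else (- acos (Re z / Cmod z))%R.

Definition Clog (z : C) : C := (ln (Cmod z), Carg z).

(* Principal branch of z^w, for z <> 0 (Coquelicot's [Cpow] only covers
   natural exponents). *)
Definition Cpower (z w : C) : C := Cexp (w * Clog z).

(* Limit of a sequence and sum of a series of complex numbers; like [RInt],
   these are total and meaningful when the limit exists. *)
Definition C_lim_seq (u : nat -> C) : C :=
  @iota C_CompleteNormedModule (fun l : C => filterlim u eventually (locally l)).

Definition C_series (u : nat -> C) : C :=
  @iota C_CompleteNormedModule (fun l : C => is_series u l).

(* z (z + 1) ... (z + n - 1) *)
Fixpoint Crising (z : C) (n : nat) : C :=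
  match n with
  | O => RtoC 1
  | S m => Crising z m * (z + RtoC (INR m))
  end.

(* The entire function 1/Gamma, given by Gauss's formula
     1/Gamma(z) = lim_n  z (z + 1) ... (z + n) / (n! n^z),
   where the limit exists for every complex z. *)
Definition CrGamma (z : C) : C :=
  C_lim_seq (fun n => Crising z (S n)
                      / (RtoC (INR (fact n)) * Cpower (RtoC (INR n)) z)).

(* Junk value at the poles 0, -1, -2, ..., where [CrGamma] vanishes. *)
Definition CGamma (z : C) : C := / CrGamma z.

(* The coefficients 1/Gamma(b + a k) are those of the entire function 1/Gamma,
   hence vanish when b + a k is a pole of Gamma. *)
Definition MittagLeffler (a b z : C) : C :=
  C_series (fun k => z ^ k * CrGamma (b + a * RtoC (INR k))).

(* Main.v *)
Require Import Defs.
From Stdlib Require Import Reals Lra Lia Factorial.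
From Coquelicot Require Import Coquelicot.

(** Put q = lambda / s^a, so that |q| < 1. Multiplying the Mittag-Leffler
    series by the prefactor and using x^c s^c = (x s)^c for x > 0, its term
    number k becomes
      s^(-b) q^k H(x s, b + a k),
      H(z, c) = Gamma (z + 1) z^c / Gamma (z + 1 + c).
    For a fixed shift c the ratio H(x s, c) tends to 1 ([Gamma_ratio_lim]), so
    the formal limit is the geometric series s^(-b) / (1 - q), which is the
    right-hand side. The exchange of limit and sum ([Tannery]) needs a
    summable bound that does not depend on x.

    An integral representation does not give this bound under the assumption
    |s^a| > |lambda|: taking moduli in the integral replaces |s| by Re s. The
    bound comes from Gauss's product instead. The principal logarithm
    satisfies |Clog (w + h) - Clog w - h / w| <= 2 |h|^2 / (Re w)^2 when
    Re w > 0 and Re h >= 0 ([Clog_increment]), and summing the logarithms of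
    the factors of Gauss's product yields the exact formula
      H(z, c) = exp (E (z, c)),  |E (z, c)| = O((1 + |c|)^2 / Re z)
    ([Gamma_ratio_Cexp], [defect_sum_bound]). This gives the limit, and a
    uniform bound as long as c stays bounded. For large c, the functional
    equation splits off the integral part of the shift, and each of its steps
    costs a factor close to 1, since |z + 1 + c + j| is at least
    |z| - |Im c| in the right half-plane. Hence |H(x s, b + a k)| is at most
    exp (1 + d a k) for any given d > 0 and x large ([Gamma_ratio_bound]); with
    d small, |q| exp (d a) < 1, and the bound is summable. *)

Local Open Scope R_scope.
Local Open Scope C_scope.

(** * Limits and series of complex numbers *)

Lemma Clim_Cmod {T : Type} {F : (T -> Prop) -> Prop} {FF : Filter F} (f : T -> C) (l : C) :
  filterlim f F (locally l) <->
  (forall eps : posreal, F (fun x => (Cmod (f x - l) < eps)%R)).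
Proof.
  exact (@filterlim_locally_ball_norm C_AbsRing T C_NormedModule F FF f l).
Qed.

Lemma Clim_pair {T : Type} {F : (T -> Prop) -> Prop} {FF : Filter F}
  (u v : T -> R) (a b : R) :
  filterlim u F (locally a) -> filterlim v F (locally b) ->
  filterlim (fun x => (u x, v x) : C) F (locally ((a, b) : C)).
Proof.
  intros Hu Hv.
  apply filterlim_locally. intros eps.
  generalize (filter_and _ _ (proj1 (filterlim_locally u a) Hu eps)
                             (proj1 (filterlim_locally v b) Hv eps)).
  apply filter_imp. intros x Hx. exact Hx.
Qed.

Lemma Clim_Re {T : Type} {F : (T -> Prop) -> Prop} {FF : Filter F} (f : T -> C) (l : C) :
  filterlim f F (locally l) -> filterlim (fun x => Re (f x)) F (locally (Re l)).
Proof.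
  intros H. apply filterlim_locally. intros eps.
  generalize (proj1 (filterlim_locally f l) H eps).
  apply filter_imp. intros x Hx. exact (proj1 Hx).
Qed.

Lemma Clim_Im {T : Type} {F : (T -> Prop) -> Prop} {FF : Filter F} (f : T -> C) (l : C) :
  filterlim f F (locally l) -> filterlim (fun x => Im (f x)) F (locally (Im l)).
Proof.
  intros H. apply filterlim_locally. intros eps.
  generalize (proj1 (filterlim_locally f l) H eps).
  apply filter_imp. intros x Hx. exact (proj2 Hx).
Qed.

Lemma Clim_plus {T : Type} {F : (T -> Prop) -> Prop} {FF : Filter F} (f g : T -> C) (l m : C) :
  filterlim f F (locally l) -> filterlim g F (locally m) ->
  filterlim (fun x => f x + g x) F (locally (l + m)).
Proof.
  intros Hf Hg.
  exact (filterlim_comp_2 f g Cplus Hf Hg (@filterlim_plus C_AbsRing C_NormedModule l m)).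
Qed.

Lemma Clim_mult {T : Type} {F : (T -> Prop) -> Prop} {FF : Filter F} (f g : T -> C) (l m : C) :
  filterlim f F (locally l) -> filterlim g F (locally m) ->
  filterlim (fun x => f x * g x) F (locally (l * m)).
Proof.
  intros Hf Hg.
  assert (Hf' : filterlim f F (@locally (AbsRing_UniformSpace C_AbsRing) l)).
  { apply (@filterlim_locally _ (AbsRing_UniformSpace C_AbsRing)); [exact FF|].
    exact (proj1 (Clim_Cmod f l) Hf). }
  exact (filterlim_comp_2 f g Cmult Hf' Hg (@filterlim_scal C_AbsRing C_NormedModule l m)).
Qed.

Lemma Clim_Cexp {T : Type} {F : (T -> Prop) -> Prop} {FF : Filter F} (f : T -> C) (l : C) :
  filterlim f F (locally l) -> filterlim (fun x => Cexp (f x)) F (locally (Cexp l)).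
Proof.
  intros H. unfold Cexp.
  assert (cont : forall (g : R -> R) (u : T -> R) (a : R), continuity_pt g a ->
    filterlim u F (locally a) -> filterlim (fun x => g (u x)) F (locally (g a))).
  { intros g u a Hg Hu. apply (filterlim_comp _ _ _ u g F (locally a)); [exact Hu|].
    now apply continuity_pt_filterlim. }
  apply Clim_mult.
  - apply Clim_pair; [|apply filterlim_const].
    apply (cont exp). apply derivable_continuous, derivable_exp. now apply Clim_Re.
  - apply Clim_pair.
    apply (cont cos). apply continuity_cos. now apply Clim_Im.
    apply (cont sin). apply continuity_sin. now apply Clim_Im.
Qed.

Lemma C_lim_seq_unique (u : nat -> C) (l : C) :
  filterlim u eventually (locally l) -> C_lim_seq u = l.
Proof.
  intros H. unfold C_lim_seq.
  exact (@iota_filterlim_locally C_AbsRing C_CompleteNormedModule nat eventually _ u l H).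
Qed.

Lemma C_series_unique (u : nat -> C) (l : C) :
  is_series (V := C_NormedModule) u l -> C_series u = l.
Proof.
  intros H. unfold C_series.
  exact (@iota_filterlim_locally C_AbsRing C_CompleteNormedModule nat eventually _
    (sum_n (G := C_AbelianMonoid) u) l H).
Qed.

Lemma Cseries_tail_le (u : nat -> C) (M : nat -> R) (U : C) (S : R) (n : nat) :
  (forall k, Cmod (u k) <= M k)%R ->
  is_series (V := C_NormedModule) u U -> is_series M S ->
  (Cmod (U - sum_n u n) <= S - sum_n M n)%R.
Proof.
  intros HM HU HS.
  assert (step : forall p, (Cmod (sum_n u (n + p) - sum_n u n) <= sum_n M (n + p) - sum_n M n)%R).
  { induction p as [|p IH].
    - rewrite Nat.add_0_r. replace (sum_n u n - sum_n u n) with (RtoC 0) by ring.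
      rewrite Cmod_0. lra.
    - rewrite Nat.add_succ_r, 2!sum_Sn.
      replace (plus (sum_n u (n + p)) (u (Datatypes.S (n + p))) - sum_n u n)
        with ((sum_n u (n + p) - sum_n u n) + u (Datatypes.S (n + p)))
        by (change plus with Cplus; ring).
      eapply Rle_trans; [apply Cmod_triangle|].
      specialize (HM (Datatypes.S (n + p))).
      change (plus (sum_n M (n + p)) (M (Datatypes.S (n + p))))
        with (sum_n M (n + p) + M (Datatypes.S (n + p)))%R. lra. }
  (* Letting p tend to infinity in step costs at most eps / 2 on each side. *)
  apply le_epsilon. intros eps Heps.
  assert (He : (0 < eps / 2)%R) by lra.
  destruct (filter_and _ _ (proj1 (Clim_Cmod _ _) HU (mkposreal _ He))
             (proj1 (filterlim_locally _ _) HS (mkposreal _ He))) as [N HN].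
  destruct (HN (n + N)%nat ltac:(lia)) as [H1 H2].
  specialize (step N).
  change (Rabs (sum_n M (n + N) - S) < eps / 2)%R in H2.
  change (Cmod (sum_n u (n + N) - U) < eps / 2)%R in H1.
  apply Rabs_def2 in H2.
  replace (U - sum_n u n) with (- (sum_n u (n + N) - U) + (sum_n u (n + N) - sum_n u n)) by ring.
  eapply Rle_trans; [apply Cmod_triangle|].
  rewrite Cmod_opp. destruct H2 as [H2 _]. lra.
Qed.

Lemma Cseries_le (u : nat -> C) (M : nat -> R) (U : C) (S : R) :
  (forall k, Cmod (u k) <= M k)%R ->
  is_series (V := C_NormedModule) u U -> is_series M S -> (Cmod U <= S)%R.
Proof.
  intros HM HU HS.
  pose proof (Cseries_tail_le u M U S 0 HM HU HS) as H.
  rewrite 2!sum_O in H. specialize (HM 0%nat).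
  replace U with ((U - u 0%nat) + u 0%nat) by ring.
  eapply Rle_trans; [apply Cmod_triangle|]. lra.
Qed.

(** Dominated convergence for series: up to tails that are small uniformly in
    x, both sides are partial sums of a fixed length, where the limit may be
    taken term by term. The domination also gives the convergence of the
    series for the x near the limit, so [C_series] is a sum there. *)
Lemma Tannery {T : Type} {F : (T -> Prop) -> Prop} {FF : ProperFilter F}
  (f : nat -> T -> C) (l : nat -> C) (M : nat -> R) (L : C) :
  ex_series M ->
  F (fun x => forall k, (Cmod (f k x) <= M k)%R) ->
  (forall k, filterlim (f k) F (locally (l k))) ->
  is_series (V := C_NormedModule) l L ->
  filterlim (fun x => C_series (fun k => f k x)) F (locally L).
Proof.
  intros [S HS] Hdom Hlim HL.
  assert (HlM : forall k, (Cmod (l k) <= M k)%R).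
  { intros k. apply le_epsilon. intros eps Heps.
    destruct (filter_ex _ (filter_and _ _ Hdom
      (proj1 (Clim_Cmod _ _) (Hlim k) (mkposreal _ Heps)))) as [x [H1 H2]].
    simpl in H2. specialize (H1 k).
    replace (l k) with (- (f k x - l k) + f k x) by ring.
    eapply Rle_trans; [apply Cmod_triangle|]. rewrite Cmod_opp. lra. }
  assert (Hsum : forall n, filterlim (fun x => sum_n (fun k => f k x) n) F (locally (sum_n l n))).
  { induction n as [|n IH].
    - rewrite sum_O. apply (filterlim_ext (f 0%nat)); [|apply Hlim].
      intros x. now rewrite sum_O.
    - rewrite sum_Sn.
      apply (filterlim_ext (fun x => sum_n (fun k => f k x) n + f (Datatypes.S n) x)).
      { intros x. now rewrite sum_Sn. }
      now apply Clim_plus. }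
  apply Clim_Cmod. intros eps.
  assert (He : (0 < eps / 3)%R) by (destruct eps; simpl; lra).
  destruct (proj1 (filterlim_locally _ _) HS (mkposreal _ He)) as [n Hn].
  specialize (Hn n (Nat.le_refl n)).
  change (Rabs (sum_n M n - S) < eps / 3)%R in Hn. apply Rabs_def2 in Hn.
  generalize (filter_and _ _ Hdom (proj1 (Clim_Cmod _ _) (Hsum n) (mkposreal _ He))).
  apply filter_imp. intros x [H1 H2]. change (Cmod (sum_n (fun k => f k x) n - sum_n l n) < eps / 3)%R in H2.
  destruct (@ex_series_le C_AbsRing C_CompleteNormedModule (fun k => f k x) M H1
              (ex_intro _ S HS)) as [U HU].
  rewrite (C_series_unique _ _ HU).
  pose proof (Cseries_tail_le _ M U S n H1 HU HS) as H3.
  pose proof (Cseries_tail_le _ M L S n HlM HL HS) as H4.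
  replace (U - L) with ((U - sum_n (fun k => f k x) n)
     + ((sum_n (fun k => f k x) n - sum_n l n) + - (L - sum_n l n))) by ring.
  eapply Rle_lt_trans; [apply Cmod_triangle|].
  pose proof (Cmod_triangle (sum_n (fun k => f k x) n - sum_n l n) (- (L - sum_n l n))) as H5.
  rewrite Cmod_opp in H5. lra.
Qed.

Lemma Cmod_lt_1_neq (q : C) : (Cmod q < 1)%R -> 1 - q <> 0.
Proof.
  intros Hq E. assert (q = 1) as -> by (replace q with (1 - (1 - q)) by ring; rewrite E; ring).
  rewrite Cmod_1 in Hq. lra.
Qed.

Lemma is_Cseries_geom (q : C) : (Cmod q < 1)%R ->
  is_series (V := C_NormedModule) (fun k => q ^ k) (/ (1 - q)).
Proof.
  intros Hq. pose proof (Cmod_lt_1_neq q Hq) as Hn.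
  assert (E : forall n, sum_n (fun k => q ^ k) n = / (1 - q) + - / (1 - q) * q ^ (S n) :> C).
  { induction n as [|n IH].
    - rewrite sum_O. simpl. field. exact Hn.
    - rewrite sum_Sn, IH. change (plus ?x ?y) with (x + y). rewrite !Cpow_S. field. exact Hn. }
  apply (filterlim_ext (fun n => / (1 - q) + - / (1 - q) * q ^ (S n))).
  { intros n. now rewrite E. }
  cut (filterlim (fun n => / (1 - q) + - / (1 - q) * q ^ (S n)) eventually
    (locally (/ (1 - q) + - / (1 - q) * 0))).
  { now rewrite Cmult_0_r, Cplus_0_r. }
  apply Clim_plus; [apply filterlim_const|].
  apply Clim_mult; [apply filterlim_const|].
  apply Clim_Cmod. intros eps.
  assert (HL : is_lim_seq (fun n => Cmod q ^ S n)%R 0%R).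
  { apply (is_lim_seq_incr_1 (fun n => Cmod q ^ n)%R). apply is_lim_seq_geom.
    rewrite Rabs_pos_eq; [exact Hq|apply Cmod_ge_0]. }
  generalize (proj1 (filterlim_locally _ _) HL eps). apply filter_imp. intros n Hn'.
  change (Rabs (Cmod q ^ S n - 0) < eps)%R in Hn'.
  rewrite Rminus_0_r in Hn'.
  replace (q ^ S n - 0) with (q ^ S n) by ring. rewrite Cmod_pow.
  eapply Rle_lt_trans; [apply Rle_abs|exact Hn'].
Qed.

(** As A is invertible, the convergence of the multiplied series is enough. *)
Lemma C_series_scal (A : C) (u : nat -> C) : A <> 0 ->
  ex_series (V := C_NormedModule) (fun k => A * u k) ->
  A * C_series u = C_series (fun k => A * u k).
Proof.
  intros HA [U HU]. rewrite (C_series_unique _ _ HU).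
  assert (H : is_series (V := C_NormedModule) u (/ A * U)).
  { apply (is_series_ext (V := C_NormedModule) (fun k => scal (/ A) (A * u k))).
    - intros k. change (/ A * (A * u k) = u k). field. exact HA.
    - exact (is_series_scal_l (V := C_NormedModule) (/ A) _ _ HU). }
  rewrite (C_series_unique _ _ H). field. exact HA.
Qed.

(** * Exponential and logarithm on the right half-plane *)

Lemma exp_nondecreasing (x y : R) : (x <= y)%R -> (exp x <= exp y)%R.
Proof. intros [H|H]; [left; now apply exp_increasing|rewrite H; lra]. Qed.

Lemma exp_pow_INR (x : R) (k : nat) : (exp x ^ k = exp (INR k * x))%R.
Proof.
  induction k as [|k IH].
  - simpl. now rewrite Rmult_0_l, exp_0.
  - rewrite S_INR, <- tech_pow_Rmult, IH, <- exp_plus. f_equal. ring.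
Qed.

Lemma Cexp_plus (u v : C) : Cexp (u + v) = Cexp u * Cexp v.
Proof.
  destruct u as [a b], v as [c d]. unfold Cexp, RtoC, Cmult; simpl.
  rewrite exp_plus, cos_plus, sin_plus. f_equal; ring.
Qed.

Lemma Cexp_RtoC (x : R) : Cexp x = exp x.
Proof.
  unfold Cexp, RtoC, Cmult; simpl. rewrite cos_0, sin_0. f_equal; ring.
Qed.

Lemma Cexp_0 : Cexp 0 = 1.
Proof. now rewrite Cexp_RtoC, exp_0. Qed.

Lemma Cmod_Cexp (u : C) : Cmod (Cexp u) = exp (Re u).
Proof.
  unfold Cexp. rewrite Cmod_mult, Cmod_R.
  rewrite Rabs_pos_eq by (left; apply exp_pos).
  unfold Cmod; simpl.
  replace (cos (Im u) * (cos (Im u) * 1) + sin (Im u) * (sin (Im u) * 1))%R with 1%R.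
  - rewrite sqrt_1; ring.
  - pose proof (sin2_cos2 (Im u)) as H. unfold Rsqr in H. lra.
Qed.

Lemma Cexp_neq_0 (u : C) : Cexp u <> 0.
Proof.
  apply Cmod_gt_0. rewrite Cmod_Cexp. apply exp_pos.
Qed.

Lemma Cexp_opp (u : C) : Cexp (- u) = / Cexp u.
Proof.
  assert (H : Cexp (- u) * Cexp u = 1).
  { rewrite <- Cexp_plus, <- Cexp_0. f_equal; ring. }
  rewrite <- (Cmult_1_l (/ Cexp u)), <- H. field. apply Cexp_neq_0.
Qed.

Lemma Re_pos_neq_0 (w : C) : (0 < Re w)%R -> w <> 0.
Proof. intros H E. rewrite E in H. simpl in H. lra. Qed.

Lemma Cmod_ge_Re (w : C) : (Re w <= Cmod w)%R.
Proof. eapply Rle_trans; [apply Rle_abs|apply re_le_Cmod]. Qed.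

(** On the right half-plane the argument is an arctangent, which can be
    differentiated without the case distinction in [Carg]. *)
Lemma Carg_atan (w : C) : (0 < Re w)%R -> Carg w = atan (Im w / Re w).
Proof.
  intros Hw.
  assert (Hm : (0 < Cmod w)%R) by (apply Cmod_gt_0, Re_pos_neq_0, Hw).
  assert (E : sqrt (1 - (Re w / Cmod w)²) = (Rabs (Im w) / Cmod w)%R).
  { rewrite <- (sqrt_Rsqr (Rabs (Im w) / Cmod w)).
    2:{ apply Rdiv_le_0_compat; [apply Rabs_pos|exact Hm]. }
    f_equal. rewrite 2!Rsqr_div', <- Rsqr_abs. unfold Rsqr.
    pose proof (Cmod2_alt w) as H. field_simplify_eq; [|lra]. lra. }
  assert (A : acos (Re w / Cmod w) = atan (Rabs (Im w) / Re w)).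
  { rewrite acos_atan by (apply Rdiv_lt_0_compat; assumption).
    rewrite E. f_equal. field. lra. }
  unfold Carg. rewrite A. destruct (Rle_dec 0 (Im w)) as [H|H].
  - now rewrite Rabs_pos_eq.
  - rewrite Rabs_left by lra. rewrite <- atan_opp. f_equal. field. lra.
Qed.

Lemma Clog_RtoC (x : R) : (0 < x)%R -> Clog x = ln x.
Proof.
  intros Hx. unfold Clog. rewrite Carg_atan by exact Hx.
  rewrite Cmod_R, Rabs_pos_eq by lra. simpl.
  unfold Rdiv. now rewrite Rmult_0_l, atan_0.
Qed.

Lemma Cexp_Clog (w : C) : (0 < Re w)%R -> Cexp (Clog w) = w.
Proof.
  intros Hw. unfold Clog, Cexp. cbn [Re Im fst snd].
  assert (Hm : (0 < Cmod w)%R) by (apply Cmod_gt_0, Re_pos_neq_0, Hw).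
  rewrite Carg_atan, exp_ln, cos_atan, sin_atan by assumption.
  replace (sqrt (1 + (Im w / Re w)²)) with (Cmod w / Re w)%R.
  - destruct w as [x y]. unfold RtoC, Cmult. cbn [Re Im fst snd] in *.
    f_equal; field; lra.
  - rewrite <- (sqrt_Rsqr (Cmod w / Re w)) by (apply Rdiv_le_0_compat; lra).
    f_equal. rewrite 2!Rsqr_div'. unfold Rsqr.
    pose proof (Cmod2_alt w) as H. field_simplify_eq; [|lra]. lra.
Qed.

Lemma Clog_scal (x : R) (w : C) : (0 < x)%R -> (0 < Re w)%R ->
  Clog (x * w) = ln x + Clog w.
Proof.
  intros Hx Hw. unfold Clog.
  assert (Hm : (0 < Cmod w)%R) by (apply Cmod_gt_0, Re_pos_neq_0, Hw).
  rewrite 2!Carg_atan.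
  - rewrite Cmod_mult, Cmod_R, Rabs_pos_eq, ln_mult by lra.
    rewrite re_scal_l, im_scal_l. unfold RtoC, Cplus; cbn [fst snd].
    f_equal. rewrite Rplus_0_l. f_equal. field. split; lra.
  - exact Hw.
  - rewrite re_scal_l. now apply Rmult_lt_0_compat.
Qed.

Lemma Cmod_Ci : Cmod Ci = 1%R.
Proof.
  unfold Cmod; simpl. rewrite Rmult_0_l, Rplus_0_l, 2!Rmult_1_l. now rewrite sqrt_1.
Qed.

Lemma Cmod_le_add (z : C) : (Cmod z <= Rabs (Re z) + Rabs (Im z))%R.
Proof.
  replace z with (RtoC (Re z) + Im z * Ci) at 1.
  - eapply Rle_trans; [apply Cmod_triangle|].
    rewrite Cmod_mult, 2!Cmod_R.
    rewrite Cmod_Ci. lra.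
  - destruct z as [x y]. apply injective_projections; simpl; ring.
Qed.

Lemma sum_sq_pos (x y : R) : (0 < x)%R -> (0 < x ^ 2 + y ^ 2)%R.
Proof. intros Hx. pose proof (pow_lt x 2 Hx). pose proof (pow2_ge_0 y). lra. Qed.

Lemma Rabs_Im_le_Cmod (z : C) : (Rabs (Im z) <= Cmod z)%R.
Proof.
  eapply Rle_trans; [|apply Rmax_Cmod]. apply Rmax_r.
Qed.

(** Second-order Taylor estimate of the logarithm. Along the segment
    w + t h the derivative is h / (w + t h), and |w + t h| >= Re w because the
    segment moves to the right; so the derivative varies by at most
    |h|^2 / (Re w)^2. The mean value theorem is applied to the real and the
    imaginary part separately, whence the factor 2. *)
Lemma Clog_increment (w h : C) : (0 < Re w)%R -> (0 <= Re h)%R ->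
  (Cmod (Clog (w + h) - Clog w - h / w) <= 2 * Cmod h ^ 2 / Re w ^ 2)%R.
Proof.
  intros Hw Hh.
  set (g := fun t : R => w + t * h).
  assert (Hg : forall t, (0 <= t)%R -> (Re w <= Re (g t))%R).
  { intros t Ht. unfold g. rewrite re_plus, re_scal_l. nra. }
  assert (D : forall t, (0 <= t)%R ->
    (Cmod (h / g t - h / w) <= t * (Cmod h ^ 2 / Re w ^ 2))%R).
  { intros t Ht. pose proof (Hg t Ht) as Hgt.
    assert (w <> 0) by now apply Re_pos_neq_0.
    assert (g t <> 0) by (apply Re_pos_neq_0; lra).
    replace (h / g t - h / w) with (- (t * (h * h) / (g t * w)))
      by (unfold g in *; field; now split).
    rewrite Cmod_opp, Cmod_div by now apply Cmult_neq_0.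
    rewrite 3!Cmod_mult, Cmod_R, Rabs_pos_eq by exact Ht.
    replace (t * (Cmod h ^ 2 / Re w ^ 2))%R with (t * (Cmod h * Cmod h) / (Re w * Re w))%R
      by (field; lra).
    apply Rmult_le_compat_l.
    - apply Rmult_le_pos; [exact Ht|]. apply Rle_0_sqr.
    - apply Rinv_le_contravar; [now apply Rmult_lt_0_compat|].
      apply Rmult_le_compat; try lra.
      + eapply Rle_trans; [exact Hgt|apply Cmod_ge_Re].
      + apply Cmod_ge_Re. }
  set (X := fun t : R => (Re w + t * Re h)%R).
  set (Y := fun t : R => (Im w + t * Im h)%R).
  assert (HX : forall t, (0 <= t)%R -> (0 < X t)%R) by (intros t Ht; unfold X; nra).
  assert (HgE : forall t, g t = (X t, Y t)).
  { intros t. unfold g, X, Y. apply injective_projections; simpl; unfold Re, Im; ring. }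
  assert (HgL : forall t, (0 <= t)%R ->
    Clog (g t) = (ln (sqrt (X t ^ 2 + Y t ^ 2)), atan (Y t / X t))).
  { intros t Ht. unfold Clog. rewrite Carg_atan; rewrite HgE; [reflexivity|].
    simpl. now apply HX. }
  assert (Hq : forall t, (0 <= t)%R -> h / g t =
    ((Re h * X t + Im h * Y t) / (X t ^ 2 + Y t ^ 2),
     (Im h * X t - Re h * Y t) / (X t ^ 2 + Y t ^ 2))%R).
  { intros t Ht. rewrite HgE. specialize (HX t Ht).
    apply injective_projections; simpl; unfold Re, Im; field;
    intros K; pose proof (sum_sq_pos _ (Y t) HX); simpl in *; lra. }
  assert (R1 : forall t, (0 <= t)%R ->
    is_derive (fun t => ln (sqrt (X t ^ 2 + Y t ^ 2))) t (Re (h / g t))).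
  { intros t Ht. rewrite Hq by exact Ht. specialize (HX t Ht). unfold X, Y in *.
    pose proof (sum_sq_pos _ (Im w + t * Im h) HX) as P.
    auto_derive.
    - simpl in P. repeat split; [exact P|now apply sqrt_lt_R0].
    - simpl in *.
      set (Q := ((Re w + t * Re h) * ((Re w + t * Re h) * 1) +
                 (Im w + t * Im h) * ((Im w + t * Im h) * 1))%R) in *.
      assert (sqrt Q * sqrt Q = Q)%R by (apply sqrt_sqrt; lra).
      pose proof (sqrt_lt_R0 _ P).
      rewrite (Rmult_assoc _ (/ (2 * sqrt Q))), <- Rinv_mult, (Rmult_assoc 2), H. field. lra. }
  assert (R2 : forall t, (0 <= t)%R ->
    is_derive (fun t => atan (Y t / X t)) t (Im (h / g t))).
  { intros t Ht. rewrite Hq by exact Ht. specialize (HX t Ht). unfold X, Y in *.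
    pose proof (sum_sq_pos _ (Im w + t * Im h) HX) as P.
    auto_derive.
    - lra.
    - simpl. unfold Rsqr. field.
      simpl in P. split; intros K; lra. }
  destruct (MVT_gen (fun t => ln (sqrt (X t ^ 2 + Y t ^ 2))) 0 1
    (fun t => Re (h / g t))) as [t1 [Ht1 E1]].
  { intros t Ht. rewrite Rmin_left in Ht by lra. apply R1. lra. }
  { intros t Ht. rewrite Rmin_left in Ht by lra.
    apply derivable_continuous_pt. eexists. apply is_derive_Reals, R1. lra. }
  destruct (MVT_gen (fun t => atan (Y t / X t)) 0 1
    (fun t => Im (h / g t))) as [t2 [Ht2 E2]].
  { intros t Ht. rewrite Rmin_left in Ht by lra. apply R2. lra. }
  { intros t Ht. rewrite Rmin_left in Ht by lra.
    apply derivable_continuous_pt. eexists. apply is_derive_Reals, R2. lra. }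
  rewrite Rmin_left, Rmax_right in Ht1, Ht2 by lra.
  eapply Rle_trans; [apply Cmod_le_add|].
  assert (E : Clog (w + h) - Clog w = (Re (h / g t1), Im (h / g t2))).
  { assert (G1 : w + h = g 1%R) by (unfold g; ring).
    assert (G0 : w = g 0%R) by (unfold g; ring).
    rewrite G1. rewrite G0 at 1. rewrite 2!HgL by lra.
    cbv beta in E1, E2. unfold Cminus, Cplus, Copp. cbn [fst snd].
    apply injective_projections; cbn [fst snd]; lra. }
  rewrite E.
  replace (Re ((Re (h / g t1), Im (h / g t2)) - h / w)) with (Re (h / g t1 - h / w))
    by reflexivity.
  replace (Im ((Re (h / g t1), Im (h / g t2)) - h / w)) with (Im (h / g t2 - h / w))
    by reflexivity.
  pose proof (Rle_trans _ _ _ (re_le_Cmod _) (D t1 (proj1 Ht1))).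
  pose proof (Rle_trans _ _ _ (Rabs_Im_le_Cmod _) (D t2 (proj1 Ht2))).
  assert (0 <= Cmod h ^ 2 / Re w ^ 2)%R.
  { apply Rdiv_le_0_compat; [apply pow2_ge_0|nra]. }
  replace (2 * Cmod h ^ 2 / Re w ^ 2)%R with (2 * (Cmod h ^ 2 / Re w ^ 2))%R
    by (unfold Rdiv; ring).
  set (B := (Cmod h ^ 2 / Re w ^ 2)%R) in *.
  assert (t1 * B <= 1 * B)%R by (apply Rmult_le_compat_r; lra).
  assert (t2 * B <= 1 * B)%R by (apply Rmult_le_compat_r; lra).
  lra.
Qed.

Lemma Cpower_plus (z u v : C) : Cpower z (u + v) = Cpower z u * Cpower z v.
Proof. unfold Cpower. rewrite <- Cexp_plus. f_equal; ring. Qed.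

Lemma Cpower_0 (z : C) : Cpower z 0 = 1.
Proof. unfold Cpower. rewrite <- Cexp_0. f_equal; ring. Qed.

Lemma Cpower_1 (z : C) : (0 < Re z)%R -> Cpower z 1 = z.
Proof. intros Hz. unfold Cpower. rewrite Cmult_1_l. now apply Cexp_Clog. Qed.

Lemma Cpower_neq_0 (z u : C) : Cpower z u <> 0.
Proof. apply Cexp_neq_0. Qed.

Lemma Cpower_opp (z u : C) : Cpower z (- u) = / Cpower z u.
Proof. unfold Cpower. rewrite <- Cexp_opp. f_equal; ring. Qed.

Lemma Cpower_mult_INR (z u : C) (k : nat) : Cpower z (u * INR k) = Cpower z u ^ k.
Proof.
  induction k as [|k IH].
  - simpl INR. rewrite Cmult_0_r. apply Cpower_0.
  - rewrite S_INR, RtoC_plus, Cmult_plus_distr_l, Cmult_1_r, Cpower_plus, IH, Cpow_S.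
    ring.
Qed.

Lemma Cpower_scal (x : R) (s u : C) : (0 < x)%R -> (0 < Re s)%R ->
  Cpower (x * s) u = Cpower x u * Cpower s u.
Proof.
  intros Hx Hs. unfold Cpower.
  rewrite Clog_scal, Clog_RtoC, <- Cexp_plus by assumption. f_equal; ring.
Qed.

(** * Shifts in Gauss's product *)

(** In w (w + 1) ... (w + n), passing from w = v to w = v + c multiplies the
    factor number j by exp (Clog (v + j + c) - Clog (v + j)). The main
    part of this exponent is c times the increment for the shift 1, which
    telescopes to c (Clog (v + n + 1) - Clog v); the defect is what remains. *)
Definition defect (v c : C) (j : nat) : C :=
  Clog (v + INR j + c) - Clog (v + INR j)
  - c * (Clog (v + INR (S j)) - Clog (v + INR j)).

Lemma INR_S_C (j : nat) : RtoC (INR (S j)) = RtoC (INR j) + 1.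
Proof. now rewrite S_INR, RtoC_plus. Qed.

Lemma Re_plus_INR (v : C) (j : nat) : Re (v + INR j) = (Re v + INR j)%R.
Proof. reflexivity. Qed.

(** The two first-order terms c / w and c * (1 / w) cancel, so the defect is
    O(1 / (Re v + j)^2). As Re v >= 1, this is at most a constant times a
    telescoping difference, which makes the total O(1 / Re v). *)
Lemma defect_bound (v c : C) (j : nat) : (1 <= Re v)%R -> (0 <= Re c)%R ->
  (Cmod (defect v c j) <=
   4 * (Cmod c ^ 2 + Cmod c) * (/ (Re v + INR j) - / (Re v + INR (S j))))%R.
Proof.
  intros Hv Hc. unfold defect.
  set (w := v + INR j).
  replace (v + INR (S j)) with (w + 1) by (unfold w; rewrite INR_S_C; ring).
  assert (Hr : Re w = (Re v + INR j)%R) by apply Re_plus_INR.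
  pose proof (pos_INR j) as Hj.
  assert (Hw : (1 <= Re w)%R) by lra.
  rewrite S_INR, <- Rplus_assoc, <- Hr.
  pose proof (Clog_increment w c ltac:(lra) Hc) as H1.
  pose proof (Clog_increment w 1 ltac:(lra) ltac:(simpl; lra)) as H2.
  rewrite Cmod_1 in H2.
  assert (w <> 0) by (apply Re_pos_neq_0; lra).
  replace (Clog (w + c) - Clog w - c * (Clog (w + 1) - Clog w))
    with ((Clog (w + c) - Clog w - c / w) + - (c * (Clog (w + 1) - Clog w - 1 / w)))
    by (field; assumption).
  eapply Rle_trans; [apply Cmod_triangle|]. rewrite Cmod_opp, Cmod_mult.
  pose proof (Cmod_ge_0 c) as Hc0.
  apply Rle_trans with (2 * (Cmod c ^ 2 + Cmod c) * (/ Re w ^ 2))%R.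
  - apply Rmult_le_compat_l with (r := Cmod c) in H2; [|exact Hc0].
    replace (2 * (Cmod c ^ 2 + Cmod c) * / Re w ^ 2)%R
      with (2 * Cmod c ^ 2 / Re w ^ 2 + Cmod c * (2 * 1 ^ 2 / Re w ^ 2))%R
      by (field; lra).
    lra.
  - replace (4 * (Cmod c ^ 2 + Cmod c) * (/ Re w - / (Re w + 1)))%R
      with (2 * (Cmod c ^ 2 + Cmod c) * (2 * (/ Re w - / (Re w + 1))))%R by ring.
    apply Rmult_le_compat_l; [pose proof (pow2_ge_0 (Cmod c)); lra|].
    replace (2 * (/ Re w - / (Re w + 1)))%R with (/ (Re w * (Re w + 1) / 2))%R
      by (field; lra).
    apply Rinv_le_contravar; nra.
Qed.

Lemma is_series_telescope (r : R) : (0 < r)%R ->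
  is_series (fun j => / (r + INR j) - / (r + INR (S j)))%R (/ r)%R.
Proof.
  intros Hr.
  assert (E : forall n, sum_n (fun j => / (r + INR j) - / (r + INR (S j)))%R n
                        = (/ r - / (r + INR (S n)))%R :> R).
  { induction n as [|n IH].
    - rewrite sum_O. change (INR 0) with 0%R. now rewrite Rplus_0_r.
    - rewrite sum_Sn, IH. change plus with Rplus. cbv beta. ring. }
  apply (filterlim_ext (fun n => / r - / (r + INR (S n)))%R); [intros n; now rewrite E|].
  assert (H : is_lim_seq (fun n => / r - / (r + INR (S n)))%R (/ r - 0)%R).
  { apply (is_lim_seq_minus' (fun _ => / r)%R (fun n => / (r + INR (S n)))%R).
    - apply is_lim_seq_const.
    - apply (is_lim_seq_inv (fun n => r + INR (S n))%R p_infty); [|easy].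
      apply (is_lim_seq_plus (fun _ => r) (fun n => INR (S n)) r p_infty p_infty).
      + apply is_lim_seq_const.
      + apply (is_lim_seq_incr_1 INR), is_lim_seq_INR.
      + easy. }
  rewrite Rminus_0_r in H. exact H.
Qed.

Lemma is_series_defect (v c : C) : (1 <= Re v)%R -> (0 <= Re c)%R ->
  is_series (V := C_NormedModule) (defect v c) (C_series (defect v c)) /\
  (Cmod (C_series (defect v c)) <= 4 * (Cmod c ^ 2 + Cmod c) / Re v)%R.
Proof.
  intros Hv Hc.
  pose proof (is_series_scal_l (K := R_AbsRing) (V := R_NormedModule) (4 * (Cmod c ^ 2 + Cmod c))%R _ _
    (is_series_telescope (Re v) ltac:(lra))) as HM.
  pose proof (fun j => defect_bound v c j Hv Hc) as HB.
  destruct (@ex_series_le C_AbsRing C_CompleteNormedModule (defect v c) _ HB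
              (ex_intro _ _ HM)) as [S HS].
  rewrite (C_series_unique _ _ HS).
  split; [exact HS|]. exact (Cseries_le _ _ _ _ HB HS HM).
Qed.

(** The sequence in Gauss's formula, of which [CrGamma] is the limit. *)
Definition gauss (n : nat) (w : C) : C :=
  Crising w (S n) / (INR (fact n) * Cpower (INR n) w).

Lemma Cexp_Clog_minus (u w : C) : (0 < Re u)%R -> (0 < Re w)%R ->
  Cexp (Clog u - Clog w) = u / w.
Proof.
  intros Hu Hw. unfold Cminus. now rewrite Cexp_plus, Cexp_opp, 2!Cexp_Clog.
Qed.

Lemma Crising_plus (v c : C) (n : nat) : (0 < Re v)%R -> (0 <= Re c)%R ->
  Crising (v + c) (S n) =
  Crising v (S n) * Cexp (sum_n (defect v c) n + c * (Clog (v + INR (S n)) - Clog v)).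
Proof.
  intros Hv Hc.
  assert (step : forall j, v + c + INR j =
     (v + INR j) * Cexp (Clog (v + INR j + c) - Clog (v + INR j))).
  { intros j. pose proof (pos_INR j).
    assert (0 < Re (v + INR j))%R by (rewrite Re_plus_INR; lra).
    rewrite Cexp_Clog_minus; [field; now apply Re_pos_neq_0|rewrite re_plus; lra|lra]. }
  induction n as [|n IH].
  - rewrite sum_O. cbn [Crising]. rewrite step, 2!Cmult_1_l. f_equal. f_equal.
    unfold defect. change (INR 0) with 0%R. rewrite Cplus_0_r. ring.
  - rewrite sum_Sn. change (Crising (v + c) (S (S n)))
      with (Crising (v + c) (S n) * (v + c + INR (S n))).
    change (Crising v (S (S n))) with (Crising v (S n) * (v + INR (S n))).
    rewrite IH, step. change (plus ?x ?y) with (x + y).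
    replace (sum_n (defect v c) n + defect v c (S n) + c * (Clog (v + INR (S (S n))) - Clog v))
      with ((sum_n (defect v c) n + c * (Clog (v + INR (S n)) - Clog v))
            + (Clog (v + INR (S n) + c) - Clog (v + INR (S n))))
      by (unfold defect; ring).
    rewrite (Cexp_plus (_ + _) (_ - _)). ring.
Qed.

Lemma RtoC_fact_neq_0 (n : nat) : RtoC (INR (fact n)) <> 0.
Proof. intros E. apply RtoC_inj in E. exact (INR_fact_neq_0 n E). Qed.

Lemma gauss_plus (v c : C) (n : nat) : (0 < Re v)%R -> (0 <= Re c)%R ->
  gauss n (v + c) * Cpower v c =
  gauss n v * (Cexp (sum_n (defect v c) n) * Cexp (c * (Clog (v + INR (S n)) - Clog (INR n)))).
Proof.
  intros Hv Hc. unfold gauss. rewrite Crising_plus by assumption.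
  rewrite Cpower_plus.
  pose proof (RtoC_fact_neq_0 n).
  (* The powers n^c of Gauss's formula and v^c absorb the telescoped sum. *)
  rewrite Cexp_plus.
  replace (Cexp (c * (Clog (v + INR (S n)) - Clog v)))
    with (Cexp (c * (Clog (v + INR (S n)) - Clog (INR n))) * Cpower (INR n) c / Cpower v c).
  - field. repeat split; try apply Cpower_neq_0. assumption.
  - unfold Cpower, Cdiv. rewrite <- Cexp_opp, <- 2!Cexp_plus. f_equal. ring.
Qed.

Lemma Cpower_INR_1 (n : nat) : (1 <= n)%nat -> Cpower (INR n) 1 = INR n.
Proof. intros Hn. apply Cpower_1. simpl. now apply lt_0_INR. Qed.

Lemma Clim_seq_INR (u : nat -> C) (l : C) (B : R) :
  (forall n, (1 <= n)%nat -> Cmod (u n - l) <= B / INR n)%R ->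
  filterlim u eventually (locally l).
Proof.
  intros H. apply Clim_Cmod. intros eps.
  assert (HB : (0 <= B)%R).
  { pose proof (H 1%nat (Nat.le_refl _)) as H1. simpl in H1.
    pose proof (Cmod_ge_0 (u 1%nat - l)). lra. }
  assert (He := cond_pos eps).
  destruct (nfloor_ex (B / eps)) as [N HN]; [now apply Rdiv_le_0_compat|].
  exists (S N). intros n Hn.
  assert (HnN : (INR N + 1 <= INR n)%R) by (rewrite <- S_INR; now apply le_INR).
  pose proof (pos_INR N).
  eapply Rle_lt_trans; [apply H; lia|].
  apply Rlt_div_l; [lra|].
  assert (B / eps < INR n)%R as HBn by lra.
  apply Rlt_div_l in HBn; lra.
Qed.

Lemma Clog_plus_INR_lim (v : C) : (0 < Re v)%R ->
  filterlim (fun n => Clog (v + INR (S n)) - Clog (INR n)) eventually (locally (RtoC 0)).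
Proof.
  intros Hv. set (K := Cmod (v + 1)).
  apply (Clim_seq_INR _ _ (K + 2 * K ^ 2)).
  intros n Hn.
  assert (Hn1 : (1 <= INR n)%R) by now apply (le_INR 1).
  assert (Hn0 : RtoC (INR n) <> 0) by (apply Re_pos_neq_0; simpl; lra).
  set (h := (v + 1) / INR n).
  assert (Hre : (0 <= Re h)%R).
  { unfold h, Cdiv. rewrite <- RtoC_inv by lra. rewrite re_scal_r, re_plus. simpl.
    apply Rmult_le_pos; [lra|]. left. apply Rinv_0_lt_compat. lra. }
  assert (Hm : (Cmod h = K / INR n)%R).
  { unfold h. rewrite Cmod_div, Cmod_R, Rabs_pos_eq by (assumption || lra). reflexivity. }
  replace (v + INR (S n)) with (INR n * (1 + h))
    by (unfold h; rewrite INR_S_C; field; assumption).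
  assert (Hre1 : (0 < Re (1 + h))%R) by (rewrite re_plus, re_RtoC; lra).
  rewrite Clog_scal, Clog_RtoC by lra.
  pose proof (Clog_increment 1 h ltac:(simpl; lra) Hre) as H.
  rewrite (Clog_RtoC 1), ln_1 in H by lra.
  replace (ln (INR n) + Clog (1 + h) - ln (INR n) - 0)
    with ((Clog (1 + h) - 0 - h / 1) + h) by (field; exact C1_nz).
  eapply Rle_trans; [apply Cmod_triangle|].
  replace (2 * Cmod h ^ 2 / Re 1 ^ 2)%R with (2 * Cmod h ^ 2)%R in H
    by (simpl; field).
  rewrite Hm in *.
  assert (HK : (0 <= K)%R) by apply Cmod_ge_0.
  assert (2 * (K / INR n) ^ 2 <= 2 * K ^ 2 / INR n)%R.
  { replace (2 * K ^ 2 / INR n)%R with (2 * (K / INR n) ^ 2 * INR n)%R by (field; lra).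
    pose proof (pow2_ge_0 (K / INR n)). nra. }
  replace ((K + 2 * K ^ 2) / INR n)%R with (K / INR n + 2 * K ^ 2 / INR n)%R by (field; lra).
  lra.
Qed.

Lemma Crising_1 (n : nat) : Crising 1 n = INR (fact n).
Proof.
  induction n as [|n IH]; [reflexivity|].
  cbn [Crising]. rewrite IH, fact_simpl, mult_INR, S_INR, RtoC_mult, RtoC_plus. ring.
Qed.

Lemma gauss_1_lim : filterlim (fun n => gauss n 1) eventually (locally (RtoC 1)).
Proof.
  apply (Clim_seq_INR _ _ 1). intros n Hn.
  assert (Hn1 : (1 <= INR n)%R) by now apply (le_INR 1).
  assert (Hn0 : RtoC (INR n) <> 0) by (apply Re_pos_neq_0; simpl; lra).
  pose proof (RtoC_fact_neq_0 n) as Hf.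
  unfold gauss. rewrite Crising_1, Cpower_INR_1, fact_simpl, mult_INR, RtoC_mult, INR_S_C
    by exact Hn.
  replace ((INR n + 1) * INR (fact n) / (INR (fact n) * INR n) - 1) with (RtoC (/ INR n)).
  - rewrite Cmod_R, Rabs_pos_eq; [unfold Rdiv; lra|]. left. apply Rinv_0_lt_compat. lra.
  - rewrite RtoC_inv by lra. field. now split.
Qed.

Lemma gauss_plus_lim (v c S G : C) : (0 < Re v)%R -> (0 <= Re c)%R ->
  is_series (V := C_NormedModule) (defect v c) S ->
  filterlim (fun n => gauss n v) eventually (locally G) ->
  filterlim (fun n => gauss n (v + c)) eventually (locally (G * Cexp S / Cpower v c)).
Proof.
  intros Hv Hc HS HG.
  apply (filterlim_ext (fun n => gauss n v *
     (Cexp (sum_n (defect v c) n) * Cexp (c * (Clog (v + INR (Datatypes.S n)) - Clog (INR n))))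
     * / Cpower v c)).
  { intros n. rewrite <- gauss_plus by assumption. field. apply Cpower_neq_0. }
  apply Clim_mult; [|apply filterlim_const].
  apply Clim_mult; [exact HG|].
  rewrite <- (Cmult_1_r (Cexp S)). apply Clim_mult.
  - apply Clim_Cexp. exact HS.
  - rewrite <- Cexp_0. apply Clim_Cexp. replace (RtoC 0) with (c * 0) by ring.
    apply Clim_mult; [apply filterlim_const|]. now apply Clog_plus_INR_lim.
Qed.

(** [CrGamma] is defined by [iota], so the existence of the limit is needed
    before anything can be said about it. Starting from w = 1, where Gauss's
    sequence is (n + 1) / n, a shift by w - 1 reaches w; the limit is not
    zero because it is an exponential up to a power. *)
Lemma CrGamma_correct (w : C) : (1 <= Re w)%R ->
  filterlim (fun n => gauss n w) eventually (locally (CrGamma w)) /\ CrGamma w <> 0.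
Proof.
  intros Hw.
  assert (Hc : (0 <= Re (w - 1))%R)
    by (unfold Cminus; rewrite re_plus, re_opp, re_RtoC; lra).
  destruct (is_series_defect 1 (w - 1) ltac:(simpl; lra) Hc) as [HS _].
  pose proof (gauss_plus_lim 1 (w - 1) _ 1 ltac:(simpl; lra) Hc HS gauss_1_lim) as H.
  replace (1 + (w - 1)) with w in H by ring.
  rewrite (C_lim_seq_unique _ _ H : CrGamma w = _). split; [exact H|].
  unfold Cdiv. rewrite <- Cpower_opp, Cmult_1_l.
  apply Cmult_neq_0; [apply Cexp_neq_0|apply Cpower_neq_0].
Qed.

(** An exact form of the asymptotics Gamma (v + c) ~ Gamma (v) v^c: the error
    factor is the exponential of a series which is O(1 / Re v). *)
Lemma CrGamma_plus (v c : C) : (1 <= Re v)%R -> (0 <= Re c)%R ->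
  CrGamma (v + c) * Cpower v c = CrGamma v * Cexp (C_series (defect v c)).
Proof.
  intros Hv Hc.
  destruct (CrGamma_correct v Hv) as [HG _].
  destruct (is_series_defect v c Hv Hc) as [HS _].
  rewrite (C_lim_seq_unique _ _ (gauss_plus_lim v c _ _ ltac:(lra) Hc HS HG)
            : CrGamma (v + c) = _).
  field. apply Cpower_neq_0.
Qed.

(** The functional equation is the shift by c = 1, where all defects vanish. *)
Lemma CrGamma_succ (w : C) : (1 <= Re w)%R -> CrGamma w = w * CrGamma (w + 1).
Proof.
  intros Hw.
  assert (HS : is_series (V := C_NormedModule) (defect w 1) (RtoC 0)).
  { apply (filterlim_ext (fun _ => RtoC 0)); [|apply filterlim_const].
    intros n. symmetry.
    transitivity (sum_n (G := C_AbelianMonoid) (fun _ => zero) n).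
    - apply sum_n_ext. intros j. unfold defect. rewrite INR_S_C, <- Cplus_assoc.
      change (Clog (w + (INR j + 1)) - Clog (w + INR j)
        - 1 * (Clog (w + (INR j + 1)) - Clog (w + INR j)) = 0 :> C). ring.
    - exact (sum_n_m_const_zero (G := C_AbelianMonoid) 0 n). }
  pose proof (CrGamma_plus w 1 Hw ltac:(simpl; lra)) as H.
  rewrite (C_series_unique _ _ HS), Cexp_0, Cpower_1, Cmult_1_r in H by lra.
  now rewrite <- H, Cmult_comm.
Qed.

Lemma CrGamma_Crising (w : C) (m : nat) : (1 <= Re w)%R ->
  CrGamma w = Crising w m * CrGamma (w + INR m).
Proof.
  intros Hw. induction m as [|m IH].
  - simpl. rewrite Cplus_0_r. ring.
  - rewrite IH, CrGamma_succ by (rewrite Re_plus_INR; pose proof (pos_INR m); lra).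
    cbn [Crising]. rewrite INR_S_C, Cplus_assoc. ring.
Qed.

(** * Quotients of Gamma values *)

(** The quantity Gamma (z + 1) z^c / Gamma (z + 1 + c), which tends to 1 as z
    goes to infinity in the right half-plane. *)
Definition Gamma_ratio (z c : C) : C :=
  CGamma (z + 1) * CrGamma (z + 1 + c) * Cpower z c.

(** By the functional equation the ratio is Gamma (z) z^(c + 1) / Gamma (z + (c + 1)).
    Basing the shift at z and not at z + 1 makes the power of z come out
    exactly. *)
Lemma Gamma_ratio_Cexp (z c : C) : (1 <= Re z)%R -> (0 <= Re c)%R ->
  Gamma_ratio z c = Cexp (C_series (defect z (c + 1))).
Proof.
  intros Hz Hc.
  pose proof (CrGamma_plus z (c + 1) Hz
    ltac:(rewrite re_plus, re_RtoC; lra)) as H.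
  destruct (CrGamma_correct (z + 1) ltac:(rewrite re_plus, re_RtoC; lra)) as [_ Hn].
  assert (z <> 0) by (apply Re_pos_neq_0; lra).
  rewrite (CrGamma_succ z), Cpower_plus, Cpower_1 in H by lra.
  replace (z + (c + 1)) with (z + 1 + c) in H by ring.
  unfold Gamma_ratio, CGamma.
  replace (Cexp (C_series (defect z (c + 1))))
    with (z * CrGamma (z + 1) * Cexp (C_series (defect z (c + 1))) / (z * CrGamma (z + 1)))
    by (field; now split).
  rewrite <- H. field. now split.
Qed.

Lemma defect_sum_bound (z c : C) (K : R) : (1 <= Re z)%R -> (0 <= Re c)%R ->
  (Cmod c <= K)%R ->
  (Cmod (C_series (defect z (c + 1))) <= 4 * ((K + 1) ^ 2 + (K + 1)) / Re z)%R.
Proof.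
  intros Hz Hc HK.
  destruct (is_series_defect z (c + 1) Hz ltac:(rewrite re_plus, re_RtoC; lra)) as [_ H].
  eapply Rle_trans; [exact H|].
  apply Rmult_le_compat_r; [left; apply Rinv_0_lt_compat; lra|].
  pose proof (Cmod_triangle c 1) as H1. rewrite Cmod_1 in H1.
  pose proof (Cmod_ge_0 (c + 1)). nra.
Qed.

Lemma Re_scal_large (s : C) (B : R) : (0 < Re s)%R ->
  Rbar_locally p_infty (fun x => (0 < x)%R /\ (B < Re (x * s))%R).
Proof.
  intros Hs. exists (Rmax 0 (B / Re s)). intros x Hx.
  pose proof (Rmax_l 0 (B / Re s)). pose proof (Rmax_r 0 (B / Re s)).
  split; [lra|]. rewrite re_scal_l. apply Rlt_div_l; lra.
Qed.

Lemma Gamma_ratio_lim (s c : C) : (0 < Re s)%R -> (0 <= Re c)%R ->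
  filterlim (fun x : R => Gamma_ratio (x * s) c) (Rbar_locally p_infty) (locally (RtoC 1)).
Proof.
  intros Hs Hc.
  apply (filterlim_ext_loc (fun x : R => Cexp (C_series (defect (x * s) (c + 1))))).
  { generalize (Re_scal_large s 1 Hs). apply filter_imp. intros x [_ Hx].
    symmetry. apply Gamma_ratio_Cexp; [lra|exact Hc]. }
  replace (locally (RtoC 1)) with (locally (Cexp 0)) by now rewrite Cexp_0.
  apply Clim_Cexp. apply Clim_Cmod. intros eps.
  set (B := (4 * ((Cmod c + 1) ^ 2 + (Cmod c + 1)))%R).
  generalize (filter_and _ _ (Re_scal_large s 1 Hs) (Re_scal_large s (B / eps) Hs)).
  apply filter_imp. intros x [[_ H1] [_ H2]]. pose proof (cond_pos eps).
  replace (C_series (defect (x * s) (c + 1)) - 0) with (C_series (defect (x * s) (c + 1)))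
    by ring.
  eapply Rle_lt_trans; [apply (defect_sum_bound _ _ (Cmod c)); lra|]. fold B.
  apply Rlt_div_l in H2; [|lra]. apply Rlt_div_l; lra.
Qed.

Lemma Cmod_le_Cmod_plus (z : C) (t : R) : (0 <= Re z)%R -> (0 <= t)%R ->
  (Cmod z <= Cmod (z + t))%R.
Proof.
  intros Hz Ht. unfold Cmod. apply sqrt_le_1_alt.
  destruct z as [x y]. simpl in *. nra.
Qed.

(** Moving z to the right does not decrease its modulus, so only the imaginary
    part of c can bring a factor z + 1 + c + j closer to 0 than z. *)
Lemma Crising_lower_bound (z c : C) (m : nat) : (0 <= Re z)%R -> (0 <= Re c)%R ->
  (Cmod (Im c) <= Cmod z)%R ->
  ((Cmod z - Cmod (Im c)) ^ m <= Cmod (Crising (z + 1 + c) m))%R.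
Proof.
  intros Hz Hc H. induction m as [|m IH].
  - simpl. rewrite Cmod_1. lra.
  - cbn [Crising pow]. rewrite Cmod_mult, Rmult_comm.
    apply Rmult_le_compat; [apply pow_le; lra|lra|exact IH|].
    pose proof (pos_INR m) as Hm.
    pose proof (Cmod_le_Cmod_plus z (1 + Re c + INR m) Hz ltac:(lra)) as H1.
    assert (E : z + (1 + Re c + INR m)%R = (z + 1 + c + INR m) + - (Im c * Ci)).
    { apply injective_projections; simpl; unfold Re, Im; ring. }
    rewrite E in H1.
    pose proof (Cmod_triangle (z + 1 + c + INR m) (- (Im c * Ci))) as H2.
    rewrite Cmod_opp, Cmod_mult in H2.
    rewrite Cmod_Ci in H2. lra.
Qed.

Lemma Gamma_ratio_INR (z c : C) (m : nat) : (1 <= Re z)%R -> (0 <= Re c)%R ->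
  Gamma_ratio z (c + INR m) * Crising (z + 1 + c) m = Gamma_ratio z c * z ^ m.
Proof.
  intros Hz Hc. unfold Gamma_ratio.
  rewrite (CrGamma_Crising (z + 1 + c) m) by (rewrite 2!re_plus, re_RtoC; lra).
  rewrite Cpower_plus.
  replace (RtoC (INR m)) with (1 * INR m) at 2 by ring.
  rewrite Cpower_mult_INR, Cpower_1, Cplus_assoc by lra. ring.
Qed.

(** The estimate [defect_sum_bound] is quadratic in the shift, hence too weak
    for large shifts. So the shift t is split into its
    integral part m and its fractional part. The fractional part leaves the
    shift in a bounded set and contributes at most exp 1. The integral part
    is a product of m quotients z / (z + 1 + c + j), each of modulus at most
    |z| / (|z| - |Im b|) <= exp d once Re z is large. *)
Lemma Gamma_ratio_bound (b : C) (d : R) : (0 <= Re b)%R -> (0 < d)%R ->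
  exists X, forall z, (X < Re z)%R -> forall t, (0 <= t)%R ->
    (Cmod (Gamma_ratio z (b + t)) <= exp (1 + d * t))%R.
Proof.
  intros Hb Hd.
  set (B := (4 * ((Cmod b + 1 + 1) ^ 2 + (Cmod b + 1 + 1)))%R).
  set (Y := (Cmod (Im b) / (1 - exp (- d)))%R).
  assert (Hd1 : (exp (- d) < 1)%R) by (rewrite <- exp_0; apply exp_increasing; lra).
  exists (Rmax 1 (Rmax B Y)). intros z Hz t Ht.
  pose proof (Rmax_l 1 (Rmax B Y)) as M1. pose proof (Rmax_r 1 (Rmax B Y)) as M2.
  pose proof (Rmax_l B Y) as M3. pose proof (Rmax_r B Y) as M4.
  pose proof (Cmod_ge_Re z) as HRe.
  assert (Hz1 : (1 <= Re z)%R) by lra.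
  destruct (nfloor_ex t Ht) as [m [Hm1 Hm2]].
  set (c := b + (t - INR m)%R).
  assert (Hc : (0 <= Re c)%R) by (unfold c; rewrite re_plus, re_RtoC; lra).
  assert (HIm : Im c = Im b) by (unfold c; rewrite im_plus, im_RtoC; lra).
  assert (HcB : (Cmod c <= Cmod b + 1)%R).
  { unfold c. eapply Rle_trans; [apply Cmod_triangle|].
    rewrite Cmod_R, Rabs_pos_eq; lra. }
  replace (b + t) with (c + INR m) by (unfold c; rewrite RtoC_minus; ring).
  assert (H1 : (Cmod (Gamma_ratio z c) <= exp 1)%R).
  { rewrite Gamma_ratio_Cexp, Cmod_Cexp by assumption.
    apply exp_nondecreasing. eapply Rle_trans; [apply Cmod_ge_Re|].
    eapply Rle_trans; [apply (defect_sum_bound z c (Cmod b + 1)); assumption|]. fold B.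
    apply Rle_div_l; lra. }
  assert (HY : (Cmod z * exp (- d) <= Cmod z - Cmod (Im b))%R).
  { assert (HYz : (Y < Cmod z)%R) by lra. unfold Y in HYz.
    apply Rlt_div_l in HYz; lra. }
  assert (Hz0 : (0 < Cmod z)%R) by lra.
  pose proof (exp_pos (- d)) as Hed.
  pose proof (Crising_lower_bound z c m ltac:(lra) Hc ltac:(rewrite HIm; nra)) as H2.
  rewrite HIm in H2.
  assert (H3 : ((Cmod z * exp (- d)) ^ m <= Cmod (Crising (z + 1 + c) m))%R).
  { eapply Rle_trans; [|exact H2]. apply pow_incr. split; [nra|exact HY]. }
  pose proof (f_equal Cmod (Gamma_ratio_INR z c m Hz1 Hc)) as H4.
  rewrite 2!Cmod_mult, Cmod_pow in H4.
  rewrite Rpow_mult_distr in H3.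
  assert (Hzm : (0 < Cmod z ^ m)%R) by now apply pow_lt.
  assert (Hem : (exp (- d) ^ m = / exp (d * INR m))%R).
  { rewrite exp_pow_INR, <- exp_Ropp. f_equal. ring. }
  rewrite Hem in H3.
  pose proof (exp_pos (d * INR m)) as Hp.
  assert (H5 : (Cmod (Gamma_ratio z (c + INR m)) <= exp 1 * exp (d * INR m))%R).
  { apply Rmult_le_reg_r with (Cmod z ^ m * / exp (d * INR m))%R.
    - apply Rmult_lt_0_compat; [exact Hzm|now apply Rinv_0_lt_compat].
    - replace (exp 1 * exp (d * INR m) * (Cmod z ^ m * / exp (d * INR m)))%R
        with (exp 1 * Cmod z ^ m)%R by (field; lra).
      apply Rle_trans with (Cmod (Gamma_ratio z (c + INR m)) * Cmod (Crising (z + 1 + c) m))%R.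
      + apply Rmult_le_compat_l; [apply Cmod_ge_0|exact H3].
      + rewrite H4. apply Rmult_le_compat_r; lra. }
  eapply Rle_trans; [exact H5|]. rewrite exp_plus.
  apply Rmult_le_compat_l; [left; apply exp_pos|]. apply exp_nondecreasing.
  apply Rmult_le_compat_l; lra.
Qed.

(** * The limit of the Mittag-Leffler series *)

Theorem mainTheorem12 (a : R) (b lambda s : C)
  (ha : (0 < a)%R) (hb : (0 < Re b)%R) (hs : (0 < Re s)%R)
  (hsl : (Cmod lambda < Cmod (Cpower s (RtoC a)))%R) :
  filterlim
    (fun x : R =>
       CGamma (RtoC x * s + RtoC 1) * Cpower (RtoC x) b
       * MittagLeffler (RtoC a) (b + RtoC x * s + RtoC 1)
           (lambda * Cpower (RtoC x) (RtoC a)))%C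
    (Rbar_locally p_infty)
    (locally (Cpower s (RtoC a - b) / (Cpower s (RtoC a) - lambda))%C).
Proof.
  set (q := lambda / Cpower s a).
  pose proof (Cpower_neq_0 s a) as Hsa.
  assert (Hq : (Cmod q < 1)%R).
  { unfold q. rewrite Cmod_div by exact Hsa.
    apply Rlt_div_l; [now apply Cmod_gt_0|lra]. }
  pose proof (Cmod_ge_0 q) as Hq0.
  (* The growth exp (d a k) allowed in the domination must stay below the decay
     |q|^k; this d turns the ratio into 2 |q| / (1 + |q|). *)
  assert (Hd : exists d, (0 < d)%R /\ (Cmod q * exp (d * a) < 1)%R).
  { exists (ln (2 / (1 + Cmod q)) / a)%R. split.
    - apply Rdiv_lt_0_compat; [|exact ha]. rewrite <- ln_1. apply ln_increasing; [lra|].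
      apply Rlt_div_r; lra.
    - replace (ln (2 / (1 + Cmod q)) / a * a)%R with (ln (2 / (1 + Cmod q))) by (field; lra).
      rewrite exp_ln by (apply Rdiv_lt_0_compat; lra).
      replace (Cmod q * (2 / (1 + Cmod q)))%R with (2 * Cmod q / (1 + Cmod q))%R by (field; lra).
      apply Rlt_div_l; lra. }
  destruct Hd as [d [Hd Hr]]. set (r := (Cmod q * exp (d * a))%R) in Hr.
  assert (Hr0 : (0 <= r)%R) by (apply Rmult_le_pos; [exact Hq0|left; apply exp_pos]).
  destruct (Gamma_ratio_bound b d ltac:(lra) Hd) as [X HX].
  (* T k x is the term number k of the series, multiplied by the prefactor. *)
  set (T := fun (k : nat) (x : R) =>
     Cpower s (- b) * q ^ k * Gamma_ratio (x * s) (b + (a * INR k)%R)).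
  set (M := fun k : nat => (Cmod (Cpower s (- b)) * exp 1 * r ^ k)%R).
  assert (HM : ex_series M).
  { apply (ex_series_scal_l (K := R_AbsRing) (V := R_NormedModule)
             (Cmod (Cpower s (- b)) * exp 1)%R (fun k => r ^ k)%R).
    apply ex_series_geom. now rewrite Rabs_pos_eq. }
  assert (Hak : forall k, (0 <= a * INR k)%R).
  { intros k. apply Rmult_le_pos; [lra|apply pos_INR]. }
  assert (HT : Rbar_locally p_infty (fun x => forall k, (Cmod (T k x) <= M k)%R)).
  { generalize (Re_scal_large s X hs). apply filter_imp. intros x [_ Hx] k.
    unfold T, M. rewrite 2!Cmod_mult, Cmod_pow.
    specialize (HX _ Hx _ (Hak k)).
    replace (Cmod (Cpower s (- b)) * exp 1 * r ^ k)%R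
      with (Cmod (Cpower s (- b)) * Cmod q ^ k * exp (1 + d * (a * INR k)))%R.
    - apply Rmult_le_compat_l; [|exact HX].
      apply Rmult_le_pos; [apply Cmod_ge_0|now apply pow_le].
    - unfold r. rewrite Rpow_mult_distr, exp_pow_INR, exp_plus.
      replace (INR k * (d * a))%R with (d * (a * INR k))%R by ring. ring. }
  apply (filterlim_ext_loc (fun x => C_series (fun k => T k x))).
  { generalize (filter_and _ _ HT (Re_scal_large s 1 hs)).
    apply filter_imp. intros x [H1 [Hx0 Hx]].
    set (A := CGamma (x * s + 1) * Cpower x b).
    assert (HA : A <> 0).
    { unfold A, CGamma. apply Cmult_neq_0; [|apply Cpower_neq_0].
      destruct (CrGamma_correct (x * s + 1) ltac:(rewrite re_plus, re_RtoC; lra)) as [_ Hn].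
      apply Cmod_gt_0. rewrite Cmod_inv by exact Hn.
      now apply Rinv_0_lt_compat, Cmod_gt_0. }
    assert (E : forall k, T k x = A * ((lambda * Cpower x a) ^ k
                 * CrGamma (b + x * s + 1 + a * INR k))).
    { intros k. unfold T, A, q, Gamma_ratio.
      rewrite RtoC_mult, Cpower_opp, Cpower_scal, 2!Cpower_plus, 2!Cpower_mult_INR by assumption.
      replace (x * s + 1 + (b + a * INR k)) with (b + x * s + 1 + a * INR k) by ring.
      unfold Cdiv. rewrite 2!Cpow_mult_l, Cpow_inv by exact Hsa.
      field. split; [now apply Cpow_nz|apply Cpower_neq_0]. }
    destruct (@ex_series_le C_AbsRing C_CompleteNormedModule (fun k => T k x) M H1 HM)
      as [U HU].
    unfold MittagLeffler.
    pose proof (is_series_ext (V := C_NormedModule) _ _ _ E HU) as HU'.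
    rewrite C_series_scal by (exact HA || (exists U; exact HU')).
    rewrite (C_series_unique _ _ HU). symmetry. now apply C_series_unique. }
  replace (Cpower s (a - b) / (Cpower s a - lambda)) with (Cpower s (- b) * / (1 - q)).
  2:{ pose proof (Cmod_lt_1_neq q Hq) as Hn.
      assert (Hn' : Cpower s a - lambda <> 0).
      { replace (Cpower s a - lambda) with (Cpower s a * (1 - q))
          by (unfold q; field; exact Hsa).
        now apply Cmult_neq_0. }
      unfold Cminus at 2. rewrite Cpower_plus. unfold q. field. now split. }
  apply (Tannery T (fun k => Cpower s (- b) * q ^ k) M); [exact HM|exact HT| |].
  - intros k. unfold T. cbv beta.
    cut (filterlim (fun x : R => Cpower s (- b) * q ^ k * Gamma_ratio (x * s) (b + (a * INR k)%R))
           (Rbar_locally p_infty) (locally (Cpower s (- b) * q ^ k * 1))).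
    { now rewrite Cmult_1_r. }
    apply Clim_mult; [apply filterlim_const|].
    apply Gamma_ratio_lim; [exact hs|]. rewrite re_plus, re_RtoC. specialize (Hak k). lra.
  - exact (is_series_scal_l (V := C_NormedModule) (Cpower s (- b)) _ _ (is_Cseries_geom q Hq)).
Qed.
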